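(* Let $G_n^{1,2}$ be the graph obtained from $n$ disjoint hexagons $H_1,\dots,H_n$, where $H_i$ has vertices $v_i^1,\dots,v_i^6$ and edges $v_i^1v_i^2,v_i^2v_i^3,\dots,v_i^5v_i^6,v_i^6v_i^1$, by adding the edge $v_i^{3}v_{i+1}^1$ for $i=1,\dots,n-1$ (the meta-phenylene chain). Then $$\lim_{n\to\infty}\mathcal{I}(G_n^{1,2})=\frac{16r^2-3r+12}{3(7r^2-4r+6)},\qquad r=\frac{7+\sqrt[3]{307+9\sqrt{182}}+\sqrt[3]{307-9\sqrt{182}}}{3}.$$
   Context: For a finite simple graph $G$: a matching is a set of pairwise vertex-disjoint edges; it is maximal if not contained in a larger matching. $\nu(G)$ is the maximum matching size, $\mathcal{T}_0(G)$ the number of maximal matchings, $\mathcal{T}_1(G)$ the sum of the sizes of all maximal matchings, and $\mathcal{I}(G)=\frac{\mathcal{T}_1(G)}{\nu(G)\mathcal{T}_0(G)}$ (equal to $1$ by convention if $\nu(G)=0$). *)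

(* Defs.v *)
From HB Require Import structures.
From mathcomp Require Import all_boot all_order all_algebra.
From mathcomp Require Import reals.

Set Implicit Arguments.
Unset Strict Implicit.
Unset Printing Implicit Defensive.

Import Order.TTheory GRing.Theory Num.Theory.

Local Open Scope ring_scope.

Record sgraph := SGraph {
  vertex : finType;
  adj : rel vertex;
  adj_sym : symmetric adj;
  adj_irrefl : irreflexive adj }.

Section Matchings.
Variable G : sgraph.

Definition edges : {set {set vertex G}} :=
  [set [set p.1; p.2] | p : vertex G * vertex G & adj p.1 p.2].

Definition matching (M : {set {set vertex G}}) : bool :=
  (M \subset edges) && trivIset M.

Definition maximal_matching (M : {set {set vertex G}}) : bool :=
  maxset matching M.

Definition matching_number : nat := (\max_(M | matching M) #|M|)%N.

Definition T0 : nat := #|[set M | maximal_matching M]|.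

Definition T1 : nat := (\sum_(M | maximal_matching M) #|M|)%N.

Definition matching_ratio (R : realType) : R :=
  if matching_number == 0%N then 1
  else T1%:R / (matching_number%:R * T0%:R).

End Matchings.

(* The pair (i, k) stands for the vertex v_{i+1}^{k+1}: hexagons and their
   vertices are both numbered from 0. *)
Definition hexagon_next n : rel ('I_n * 'I_6) := fun x y =>
  (x.1 == y.1) && (val y.2 == x.2.+1 %% 6)%N.

(* (x, y) = (v_i^3, v_{i+1}^1) *)
Definition meta_link n : rel ('I_n * 'I_6) := fun x y =>
  [&& val y.1 == (val x.1).+1, val x.2 == 2%N & val y.2 == 0%N].

Definition meta_adj n : rel ('I_n * 'I_6) := fun x y =>
  [|| hexagon_next x y, hexagon_next y x, meta_link x y | meta_link y x].

Lemma meta_adj_sym n : symmetric (@meta_adj n).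
Proof.
move=> x y; rewrite /meta_adj.
by case: (hexagon_next x y); case: (hexagon_next y x);
  case: (meta_link x y); case: (meta_link y x).
Qed.

Lemma meta_adj_irrefl n : irreflexive (@meta_adj n).
Proof.
move=> [i [k hk]]; rewrite /meta_adj /hexagon_next /meta_link /= eqxx /=.
by rewrite (ltn_eqF (ltnSn i)) /= !orbF; do 6?[case: k hk => // k hk].
Qed.

Definition meta_phenylene_chain (n : nat) : sgraph :=
  @SGraph _ (@meta_adj n) (@meta_adj_sym n) (@meta_adj_irrefl n).

(* Main.v *)
(** Encode a maximal matching of the chain hexagon by hexagon.  The interaction
    between consecutive hexagons goes through the link only, so it is recorded
    by three states: link used, or link unused with its left end covered or
    exposed.  Eliminating the states from the 3x3 transfer recursion, the number
    t_n of maximal matchings and their total size s_n satisfy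
      t_(n+3) = 7 t_(n+2) - 2 t_(n+1) + 2 t_n,
      s_(n+3) = 7 s_(n+2) - 2 s_(n+1) + 2 s_n
                + 16 t_(n+2) - 3 t_(n+1) + 12 t_n,
    while the matching number is 3n.  By Cardano r is the real root of
    X^3 - 7 X^2 + 2 X - 2, and the cofactor of X - r is contracting.  Hence
    t_(n+1) - r t_n is bounded and t_n is at least a multiple of r^n.  For
    K = (16 r^2 - 3 r + 12) / (7 r^2 - 4 r + 6) the same contraction, applied to
    s_n - K n t_n, gives s_n - K n t_n = O(r^n), so s_n / (3 n t_n) tends to
    K / 3. *)

Require Import Defs.
From mathcomp Require Import all_boot all_order all_algebra.
From mathcomp Require Import zify.

Set Implicit Arguments.
Unset Strict Implicit.
Unset Printing Implicit Defensive.

(** * Maximal matchings of simple graphs *)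

Section SimpleGraphs.
Variable G : sgraph.
Implicit Types (M : {set {set vertex G}}) (v : vertex G).

Definition degree M v := #|[set e in M | v \in e]|.

Lemma cover_degree M v : (v \in cover M) = (0 < degree M v).
Proof.
apply/bigcupP/card_gt0P => [[e eM ve]|[e]]; first by exists e; rewrite inE eM.
by rewrite inE => /andP[eM ve]; exists e.
Qed.

Lemma trivIset_degree M : trivIset M = [forall v, degree M v <= 1].
Proof.
apply/trivIsetP/forallP => [tM v|dM e f eM fM].
  apply/card_le1_eqP => e f; rewrite !inE => /andP[eM ve] /andP[fM vf].
  apply/eqP/negPn/negP => nef.
  by have /disjointFr/(_ vf) := tM _ _ fM eM nef; rewrite ve.
apply: contraR => /pred0Pn[v /andP[ve vf]].
by apply/eqP/(card_le1_eqP (dM v)); rewrite inE ?eM ?fM.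
Qed.

(** An edge with no covered end could be added to [M], so maximality means that every edge has a
    covered end. All conditions then concern degrees and can be checked hexagon by hexagon. *)
Lemma maximal_matchingE M : maximal_matching M =
  [&& M \subset edges G, [forall v, degree M v <= 1] &
      [forall e in edges G, [exists v in e, 0 < degree M v]]].
Proof.
rewrite -trivIset_degree andbA -/(matching M); apply/maxsetP/andP.
  move=> [mM maxM]; split=> //; have /andP[sM tM] := mM.
  apply/forall_inP => e eE; apply: contraT => /exists_inPn ncov.
  have disj f : f \in M -> [disjoint e & f].
    move=> fM; apply/pred0P => v /=; apply/negP => /andP[ve vf].
    have /negP[] := ncov v ve; rewrite -cover_degree.
    by apply/bigcupP; exists f.
  have eM : e |: M = M.
    apply: maxM; last exact: subsetUr.
    rewrite /matching subUset sub1set eE sM /=.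
    apply/trivIsetP => f g /setU1P[->|fM] /setU1P[->|gM] nfg.
    - by rewrite eqxx in nfg.
    - exact: disj.
    - by rewrite disjoint_sym disj.
    - exact: (trivIsetP tM).
  have eM' : e \in M by rewrite -eM setU11.
  move/imsetP: eE => [p _ ep].
  have pe : p.1 \in e by rewrite ep set21.
  by have /negP[] := ncov _ pe; rewrite -cover_degree; apply/bigcupP; exists e.
move=> [mM covM]; split=> // N /andP[sN tN] sMN.
apply/eqP; rewrite eqEsubset sMN andbT; apply/subsetP => e eN.
have /exists_inP[v ve] := forall_inP covM e (subsetP sN e eN).
rewrite -cover_degree => /bigcupP[f fM vf].
have [->//|nef] := eqVneq e f.
have /disjointFr/(_ ve) := trivIsetP tN _ _ eN (subsetP sMN _ fM) nef.
by rewrite vf.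
Qed.

Lemma card_edge e : e \in edges G -> #|e| = 2.
Proof.
case/imsetP => p; rewrite inE => adjp ->; rewrite cards2.
by case: eqP adjp => // ->; rewrite adj_irrefl.
Qed.

Lemma matching_card M : matching M -> #|M|.*2 <= #|vertex G|.
Proof.
move=> /andP[sM tM]; apply: leq_trans (max_card (cover M)).
rewrite -(eqP tM) (eq_bigr (fun=> 2)) ?sum_nat_const ?muln2//.
by move=> e /(subsetP sM)/card_edge.
Qed.

End SimpleGraphs.

(** * The transfer recursion *)

(* A letter lists the edges of a matching at one hexagon: bit k < 6 is the edge
   joining vertices k and k + 1 mod 6, bit 6 the link to the next hexagon. *)
Notation letter := (7.-tuple bool).

Definition bit (l : seq bool) k := nth false l k.

(* What the next hexagon needs to know: whether the link is used, and whether
   its left end is exposed. *)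
Definition exit_state (l : seq bool) : bool * bool :=
  (bit l 6, ~~ [|| bit l 1, bit l 2 | bit l 6]).

(* [q] tells whether the incoming link at vertex 0 is used. *)
Definition incident (q : bool) (l : seq bool) k : seq bool :=
  match k with
  | 0 => [:: bit l 5; bit l 0; q]
  | 2 => [:: bit l 1; bit l 2; bit l 6]
  | k'.+1 => [:: bit l k'; bit l k]
  end.

Definition local_degree q l k := count id (incident q l k).

(** The last conjunct is maximality at the incoming link: when its left end is exposed, its right
    end, vertex 0, must be covered. *)
Definition admissible (s : bool * bool) (l : seq bool) :=
  all (fun k => (local_degree s.1 l k <= 1) &&
                ((0 < local_degree s.1 l k) ||
                 (0 < local_degree s.1 l (k.+1 %% 6)))) (iota 0 6)
  && (s.2 ==> (0 < local_degree s.1 l 0)).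

(** The end condition forbids a link leaving the last hexagon. *)
Fixpoint good (s : bool * bool) (w : seq letter) :=
  if w is l :: w' then admissible s l && good (exit_state l) w' else ~~ s.1.

Definition weight (w : seq letter) := \sum_(l <- w) count id l.

(** Also the initial state: the first hexagon has no incoming link, hence no obligation on its
    left. *)
Definition covered : bool * bool := (false, false).
Definition linked : bool * bool := (true, false).
Definition exposed : bool * bool := (false, true).

Definition blank : letter := [tuple of nseq 7 false].

Definition entry_state (s : bool * bool) (w : seq letter) i :=
  if i is j.+1 then exit_state (nth blank w j) else s.

Lemma goodP s (w : seq letter) :
  reflect ((forall i, i < size w ->
              admissible (entry_state s w i) (nth blank w i))
           /\ ~~ (entry_state s w (size w)).1) (good s w).
Proof.
elim: w s => [|l w IHw] s /=; first by apply: (iffP idP) => [|[]].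
apply: (iffP andP) => [[al /IHw[H1 H2]]|[H1 H2]].
  split; last by case: (w) H2.
  by case=> [|i] //= /H1; case: i.
split; first exact: (H1 0).
apply/IHw; split; last by case: (w) H2.
by move=> i /(H1 i.+1); case: i.
Qed.

Lemma sum_tupleS (T : finType) n (F : n.+1.-tuple T -> nat) :
  \sum_w F w = \sum_x \sum_(w : n.-tuple T) F [tuple of x :: w].
Proof.
rewrite pair_bigA /=.
rewrite (reindex (fun p : T * n.-tuple T => [tuple of p.1 :: p.2])) //=.
exists (fun w : n.+1.-tuple T => (thead w, [tuple of behead w])).
  by move=> [x w] _ /=; rewrite theadE; congr (_, _); apply: val_inj.
by move=> w _; rewrite /= -tuple_eta.
Qed.

(** An enumeration that evaluates, so that the letters allowed in each state can be found by
    computation. *)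
Fixpoint bitseqs n : seq (seq bool) :=
  if n is n'.+1 then
    [seq true :: l | l <- bitseqs n'] ++ [seq false :: l | l <- bitseqs n']
  else [:: [::]].

Lemma sum_bitseqs n (F : seq bool -> nat) :
  \sum_(l : n.-tuple bool) F l = \sum_(l <- bitseqs n) F l.
Proof.
elim: n F => [|n IHn] F.
  rewrite big_seq1 (big_pred1 [tuple]) // => l /=.
  by rewrite tuple0; apply/esym/eqP.
by rewrite sum_tupleS big_bool /= (IHn (fun l => F (true :: l)))
  (IHn (fun l => F (false :: l))) big_cat !big_map.
Qed.

Definition transitions s : seq (nat * (bool * bool)) :=
  [seq (count id l, exit_state l) | l <- bitseqs 7 & admissible s l].

Lemma sum_letters s (F : nat -> bool * bool -> nat) :
  \sum_(l : letter | admissible s l) F (count id l) (exit_state l) =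
  \sum_(z <- transitions s) F z.1 z.2.
Proof.
rewrite big_mkcond /= (sum_bitseqs 7 (fun l => if admissible s l then
  F (count id l) (exit_state l) else 0)) /transitions big_map big_filter.
by rewrite [RHS]big_mkcond.
Qed.

Definition good_count s n := \sum_(w : n.-tuple letter | good s w) 1.
Definition good_weight s n := \sum_(w : n.-tuple letter | good s w) weight w.

Lemma good_count0 s : good_count s 0 = ~~ s.1.
Proof.
rewrite /good_count big_mkcond (big_pred1 [tuple]) => [|w /=].
  by case: s => -[].
by rewrite tuple0; apply/esym/eqP.
Qed.

Lemma good_countS s n :
  good_count s n.+1 = \sum_(z <- transitions s) good_count z.2 n.
Proof.
rewrite -(sum_letters s (fun _ s' => good_count s' n)).
rewrite /good_count big_mkcond sum_tupleS [RHS]big_mkcond.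
apply: eq_bigr => l _ /=.
by case: admissible => /=; [rewrite -big_mkcond | rewrite big1].
Qed.

Lemma good_weightS s n :
  good_weight s n.+1 =
  \sum_(z <- transitions s) (z.1 * good_count z.2 n + good_weight z.2 n).
Proof.
rewrite -(sum_letters s (fun k s' => k * good_count s' n + good_weight s' n)).
rewrite /good_weight big_mkcond sum_tupleS [RHS]big_mkcond.
apply: eq_bigr => l _ /=; case: admissible => /=; last by rewrite big1.
rewrite -big_mkcond /good_count big_distrr -big_split /=.
by apply: eq_bigr => w _; rewrite /weight big_cons muln1.
Qed.

(** The coefficients form the transfer matrix, obtained by testing all 128 letters in each state. *)
Lemma good_count_step n :
  [/\ good_count covered n.+1 = 4 * good_count covered n +
        3 * good_count linked n + good_count exposed n,
      good_count linked n.+1 = 3 * good_count covered n +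
        2 * good_count linked n &
      good_count exposed n.+1 = 3 * good_count covered n +
        3 * good_count linked n + good_count exposed n].
Proof.
(* Only the list of transitions is evaluated; the counts stay symbolic. *)
by split; rewrite good_countS; set z := transitions _; vm_compute in z;
  rewrite {}/z !big_cons big_nil /covered /linked /exposed /=; lia.
Qed.

(** The coefficients of the counts are numbers of edges: for example, the four letters leading from
    [covered] to [covered] have 10 edges in total. *)
Lemma good_weight_step n :
  [/\ good_weight covered n.+1 = 4 * good_weight covered n +
        3 * good_weight linked n + good_weight exposed n +
        (10 * good_count covered n + 9 * good_count linked n +
         2 * good_count exposed n),
      good_weight linked n.+1 = 3 * good_weight covered n +
        2 * good_weight linked n +
        (6 * good_count covered n + 4 * good_count linked n) &
      good_weight exposed n.+1 = 3 * good_weight covered n +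
        3 * good_weight linked n + good_weight exposed n +
        (8 * good_count covered n + 9 * good_count linked n +
         2 * good_count exposed n)].
Proof.
by split; rewrite good_weightS; set z := transitions _; vm_compute in z;
  rewrite {}/z !big_cons big_nil /covered /linked /exposed /=; lia.
Qed.

Lemma good_count_init :
  [/\ good_count covered 0 = 1, good_count covered 1 = 5 &
      good_count covered 2 = 33].
Proof.
have [h1 h2 h3] := good_count_step 0; have [k1 _ _] := good_count_step 1.
by rewrite k1 h1 h2 h3 !good_count0.
Qed.

(** Cayley-Hamilton: X^3 - 7 X^2 + 2 X - 2 is the characteristic polynomial of the transfer matrix.
    Negative terms change sides to stay in the natural numbers. *)
Lemma good_count_rec n : good_count covered n.+3 + 2 * good_count covered n.+1 =
  7 * good_count covered n.+2 + 2 * good_count covered n.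
Proof.
have [h1 h2 h3] := good_count_step n; have [k1 k2 k3] := good_count_step n.+1.
have [l1 _ _] := good_count_step n.+2; lia.
Qed.

(** Marking edges by a variable turns the matrix entries into polynomials; 16, 3 and 12 are the
    derivatives at 1 of the trace, of the sum of the principal 2x2 minors and of the determinant. *)
Lemma good_weight_rec n :
  good_weight covered n.+3 + 2 * good_weight covered n.+1 +
  3 * good_count covered n.+1 =
  7 * good_weight covered n.+2 + 2 * good_weight covered n
  + (16 * good_count covered n.+2 + 12 * good_count covered n).
Proof.
have [h1 h2 h3] := good_count_step n; have [k1 k2 k3] := good_count_step n.+1.
have [l1 _ _] := good_count_step n.+2.
have [h1' h2' h3'] := good_weight_step n.
have [k1' k2' k3'] := good_weight_step n.+1.
have [l1' _ _] := good_weight_step n.+2; lia.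
Qed.

Lemma card_set_sum (T : finType) (P : pred T) : #|[set x | P x]| = \sum_x P x.
Proof.
by rewrite -sum1dep_card big_mkcond; apply: eq_bigr => x _; case: (P x).
Qed.

Lemma sum_pair (I J : finType) (F : I * J -> nat) :
  \sum_p F p = \sum_i \sum_j F (i, j).
Proof. by rewrite pair_bigA; apply: eq_bigr => -[]. Qed.

(** A perfect matching of one hexagon; repeated, it is a perfect matching of the chain and attains
    the upper bound on the matching number. *)
Definition kekule_letter : letter :=
  [tuple true; false; true; false; true; false; false].

Lemma good_kekule m : good covered (nseq m kekule_letter).
Proof. by elim: m. Qed.

Lemma weight_kekule m : weight (nseq m kekule_letter) = 3 * m.
Proof. by rewrite /weight big_nseq iter_addn_0. Qed.

(** * Matchings of the chain as words *)

Section Chain.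
Variable n : nat.
Local Notation chain := (meta_phenylene_chain n.+1).
Local Notation vert := ('I_n.+1 * 'I_6)%type.
Local Notation slot := ('I_n.+1 * 'I_7)%type.
Implicit Types (e : slot) (v : vert) (w : n.+1.-tuple letter).
Implicit Types M : {set {set vertex chain}}.

Definition tailv e : vert := (e.1, inord (if e.2 < 6 then e.2 : nat else 2)).
(** At the link slot of the last hexagon, [inord] falls back on hexagon 0; [is_slot] excludes this
    spurious edge. *)
Definition headv e : vert :=
  if e.2 < 6 then (e.1, inord (e.2.+1 %% 6)) else (inord e.1.+1, ord0).
Definition edge_of e : {set vertex chain} := [set tailv e; headv e].

(* The link slot of the last hexagon carries no edge. *)
Definition is_slot e := (e.2 < 6) || (e.1 < n).

Lemma in_edge_of v e : is_slot e -> (v \in edge_of e) =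
  if e.2 < 6 then
    (v.1 == e.1) && ((v.2 == e.2 :> nat) || (v.2 == e.2.+1 %% 6 :> nat))
  else ((v.1 == e.1) && (v.2 == 2 :> nat)) ||
       ((v.1 == e.1.+1 :> nat) && (v.2 == 0 :> nat)).
Proof.
move=> se; rewrite !inE; case: v => i k; rewrite /tailv /headv.
move: se; rewrite /is_slot; case: ifP => e6 /= se;
  rewrite !xpair_eqE -!val_eqE /= !inordK ?ltn_mod ?ltnS//.
by case: (_ == _).
Qed.

Lemma tail_in e : tailv e \in edge_of e. Proof. exact: set21. Qed.
Lemma head_in e : headv e \in edge_of e. Proof. exact: set22. Qed.

Lemma edge_of_inj : {in is_slot &, injective edge_of}.
Proof.
move=> e f se sf ef; apply/eqP.
have := tail_in e; have := head_in e; rewrite ef !in_edge_of //.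
move: se sf {ef}; rewrite /in_mem /= /is_slot /tailv /headv.
case: e f => [i k] [j l] /=; have := ltn_ord k; have := ltn_ord l => l7 k7.
rewrite xpair_eqE -!val_eqE /=.
by case: ifP => k6 se; case: ifP => l6 sf; rewrite /= ?inordK ?ltn_mod //; lia.
Qed.

Lemma adj_edge_of e : is_slot e -> @meta_adj n.+1 (tailv e) (headv e).
Proof.
rewrite /is_slot /meta_adj /tailv /headv /hexagon_next /meta_link.
case: ifP => e6 se; rewrite /= ?eqxx ?inordK ?ltn_mod //= ?eqxx //.
by rewrite !orbT.
Qed.

Lemma edge_of_adj x y : hexagon_next x y || @meta_link n.+1 x y ->
  exists2 e, is_slot e & [set x; y] = edge_of e.
Proof.
case: x y => [i k] [j l].
rewrite /hexagon_next /meta_link /edge_of /tailv /headv /=.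
have k6 := ltn_ord k.
case/orP=> [/andP[/eqP<- /eqP kl]|/and3P[/eqP ij /eqP k2 /eqP l0]].
  have k7 : k < 7 by apply: ltnW.
  exists (i, inord k); first by rewrite /is_slot /= inordK // k6.
  rewrite /= inordK // k6.
  by congr [set _; _]; congr (_, _); apply: val_inj; rewrite /= inordK ?ltn_mod.
exists (i, inord 6); first by rewrite /is_slot /= inordK //= -ltnS -ij.
rewrite /= inordK //=; congr [set _; _]; congr (_, _); apply: val_inj => //=.
- by rewrite inordK.
- by rewrite inordK -?ij.
Qed.

Lemma edgesE : edges chain = edge_of @: [set e | is_slot e].
Proof.
apply/setP => E; apply/imsetP/imsetP => [[[x y]]|[e]]; rewrite inE /=.
  move=> adjxy ->.
  have [e se ->] : exists2 e, is_slot e & [set x; y] = edge_of e.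
    move: adjxy; rewrite /meta_adj => /or4P[] h.
    - by apply: edge_of_adj; rewrite h.
    - by rewrite setUC; apply: edge_of_adj; rewrite h.
    - by apply: edge_of_adj; rewrite h orbT.
    - by rewrite setUC; apply: edge_of_adj; rewrite h orbT.
  by exists e; rewrite ?inE.
by move=> /adj_edge_of adje ->; exists (tailv e, headv e); rewrite ?inE.
Qed.

Definition wbit w e := bit (tnth w e.1) e.2.

Definition matching_of w := edge_of @: [set e | wbit w e].

Definition word_of (M : {set {set vertex chain}}) : n.+1.-tuple letter :=
  [tuple [tuple is_slot (i, k) && (edge_of (i, k) \in M) | k < 7] | i < n.+1].

Lemma wbit_word_of M e : wbit (word_of M) e = is_slot e && (edge_of e \in M).
Proof. by case: e => i k; rewrite /wbit /bit -tnth_nth !tnth_mktuple. Qed.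

Definition word_closed w := [forall e, wbit w e ==> is_slot e].

Lemma wbit_slot w e : word_closed w -> wbit w e -> is_slot e.
Proof. by move/forallP/(_ e)/implyP. Qed.

Lemma word_ofK M : M \subset edges chain -> matching_of (word_of M) = M.
Proof.
move=> sM; apply/setP => E; apply/imsetP/idP => [[e]|EM].
  by rewrite inE wbit_word_of => /andP[_ eM] ->.
have := subsetP sM E EM; rewrite edgesE => /imsetP[e]; rewrite inE => se Ee.
by exists e; rewrite // inE wbit_word_of se -Ee.
Qed.

Lemma wbit_matching_of w e : word_closed w -> is_slot e ->
  (edge_of e \in matching_of w) = wbit w e.
Proof.
move=> cw se; apply/imsetP/idP => [[f]|we]; last by exists e; rewrite ?inE.
by rewrite inE => wf /edge_of_inj -> //; apply: wbit_slot wf.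
Qed.

(** [word_of] never sets the missing last link, and this is the only obstruction to recovering [w],
    since an edge determines its slot. *)
Lemma matching_ofK w : (word_of (matching_of w) == w) = word_closed w.
Proof.
apply/eqP/idP => [<-|cw].
  by apply/forallP => e; rewrite wbit_word_of; apply/implyP; case/andP.
apply: eq_from_tnth => i; apply: eq_from_tnth => k.
have := wbit_word_of (matching_of w) (i, k).
rewrite /wbit /bit -!tnth_nth /= => ->.
have [se|nse] := boolP (is_slot (i, k)).
  by rewrite wbit_matching_of // /wbit /bit -tnth_nth.
apply/esym/negP => wik; case/negP: nse; apply: wbit_slot cw _.
by rewrite /wbit /bit -tnth_nth.
Qed.

Lemma card_matching_of w : word_closed w -> #|matching_of w| = weight w.
Proof.
move=> cw; rewrite card_in_imset; last first.
  move=> e f; rewrite !inE => we wf.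
  by apply: edge_of_inj; [exact: (wbit_slot cw we) | exact: (wbit_slot cw wf)].
rewrite /weight big_tuple card_set_sum sum_pair.
apply: eq_bigr => i _; rewrite -sum1_count [RHS]big_mkcond big_tuple /=.
apply: eq_bigr => k _; rewrite /wbit /bit -tnth_nth.
by case: (tnth (tnth w i) k).
Qed.

Lemma sum_at (i : 'I_n.+1) (F : pred 'I_n.+1) : \sum_j (F j && (i == j)) = F i.
Proof.
rewrite (bigD1 i) //= eqxx andbT big1 ?addn0 // => j.
by rewrite eq_sym => /negPf ->; rewrite andbF.
Qed.

Lemma sum_before (i : 'I_n.+1) (F : pred 'I_n.+1) :
  \sum_j (F j && (i == j.+1 :> nat)) =
  if i : nat is i'.+1 then F (inord i') : nat else 0.
Proof.
case: i => [[|i] hi] /=; first by rewrite big1 // => j _; rewrite andbF.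
have hi' : i < n.+1 by apply: ltnW.
rewrite -(sum_at (inord i) F); apply: eq_bigr => j _.
by rewrite eqSS -val_eqE /= inordK.
Qed.

(** A vertex meets only slots of its own hexagon and, if it is vertex 0, the preceding link, whose
    use the entry state records. *)
Lemma degree_matching_of w v : word_closed w -> degree (matching_of w) v =
  local_degree (entry_state covered w v.1).1 (tnth w v.1) v.2.
Proof.
move=> cw; rewrite /degree.
have -> : [set e in matching_of w | v \in e] =
          edge_of @: [set e | wbit w e && (v \in edge_of e)].
  apply/setP => E; rewrite inE; apply/andP/imsetP.
    move=> [/imsetP[e]]; rewrite inE => we -> ve.
    by exists e; rewrite // inE we.
  move=> [e]; rewrite inE => /andP[we ve] ->; split=> //.
  by apply/imsetP; exists e; rewrite ?inE.
rewrite card_in_imset; last first.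
  move=> e f; rewrite !inE => /andP[we _] /andP[wf _].
  by apply: edge_of_inj; [exact: (wbit_slot cw we) | exact: (wbit_slot cw wf)].
rewrite card_set_sum (eq_bigr (fun e => (wbit w e && (if e.2 < 6 then
    (v.1 == e.1) && ((v.2 == e.2 :> nat) || (v.2 == e.2.+1 %% 6 :> nat))
  else ((v.1 == e.1) && (v.2 == 2 :> nat)) ||
       ((v.1 == e.1.+1 :> nat) && (v.2 == 0 :> nat)))) : nat)); last first.
  move=> e _; have [we|//] := boolP (wbit w e).
  by rewrite in_edge_of ?(wbit_slot cw).
rewrite sum_pair exchange_big /=; set q := (entry_state _ _ _).1.
set l := tnth w v.1.
have qE : \sum_i (wbit w (i, ord_max) && (v.1 == i.+1 :> nat)) = q.
  rewrite sum_before /q; case: (v.1) => [[|j] hj] //=.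
  by rewrite /wbit /= (tnth_nth blank) /= inordK // ltnW.
(* [G k] collects the contribution of bit [k] over all hexagons. The link bit counts twice: for the
   outgoing link at vertex 2 and for the incoming one at vertex 0. *)
pose G k : nat := if k < 6 then
  (bit l k && ((v.2 == k :> nat) || (v.2 == k.+1 %% 6 :> nat)) : nat)
  else (bit l 6 && (v.2 == 2 :> nat)) + (q && (v.2 == 0 :> nat)).
rewrite (eq_bigr (fun k : 'I_7 => G k)) => [|k _].
  rewrite !big_ord_recr big_ord0 /G /local_degree /=.
  by case: (v.2) => [[|[|[|[|[|[|k]]]]]] hk] //=; rewrite ?andbT ?andbF; lia.
rewrite /G; case: ifP => k6.
  rewrite -(sum_at v.1 (fun i => bit (tnth w i) k && _)); apply: eq_bigr => i _.
  by rewrite -andbA [in RHS](andbC _ (_ == _)).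
have -> : k = ord_max by apply: val_inj => /=; have := ltn_ord k; lia.
have [v20|v20] := eqVneq (v.2 : nat) 0.
  rewrite v20 /= andbF andbT add0n -qE; apply: eq_bigr => i _.
  by rewrite andbF andbT.
rewrite andbF addn0 -(sum_at v.1 (fun i => bit (tnth w i) 6 && _)).
apply: eq_bigr => i _; rewrite andbF orbF -andbA.
by rewrite [in RHS](andbC _ (_ == _)).
Qed.

Lemma exists_in_edge_of e (P : pred (vertex chain)) :
  [exists v in edge_of e, P v] = P (tailv e) || P (headv e).
Proof.
apply/exists_inP/orP => [[v]|[Pv|Pv]].
- by rewrite !inE => /orP[] /eqP ->; [left | right].
- by exists (tailv e); rewrite ?tail_in.
- by exists (headv e); rewrite ?head_in.
Qed.

Lemma nth_wordE w (i : 'I_n.+1) : nth blank w i = tnth w i.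
Proof. by rewrite -tnth_nth. Qed.

Lemma good_closed w : good covered w -> word_closed w.
Proof.
case/goodP; rewrite size_tuple [entry_state _ _ _]/(exit_state _) => _.
rewrite (nth_wordE w ord_max) => nlast.
apply/forallP => -[i k]; apply/implyP; rewrite /wbit /is_slot /= => wik.
rewrite orbC; have [//|ni /=] := ltnP i n.
rewrite ltn_neqAle -ltnS ltn_ord andbT.
apply: contraNneq nlast => k6.
have <- : i = ord_max.
  by apply: val_inj; apply/eqP; rewrite eqn_leq ni -ltnS ltn_ord.
by move: wik; rewrite k6.
Qed.

(** The incoming link ends at vertex 0, so the degree at vertex 2 is the same for either [q]. *)
Lemma exit_exposed q (l : seq bool) :
  (exit_state l).2 = ~~ (0 < local_degree q l 2).
Proof.
rewrite /local_degree /incident /exit_state.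
by case: (bit l 1); case: (bit l 2); case: (bit l 6).
Qed.

Lemma hexagon_edge_of (i : 'I_n.+1) (k : 'I_6) :
  let e := (i, widen_ord (leqnSn 6) k) in
  [/\ is_slot e, tailv e = (i, k) & headv e = (i, inord (k.+1 %% 6))].
Proof.
rewrite /is_slot /tailv /headv /= ltn_ord; split=> //.
by congr (_, _); rewrite inord_val.
Qed.

Lemma link_edge_of (i : 'I_n.+1) (hi : i.+1 < n.+1) :
  let e := (i, ord_max : 'I_7) in
  [/\ is_slot e, tailv e = (i, Ordinal (isT : 2 < 6)) &
      headv e = (Ordinal hi, ord0)].
Proof.
rewrite /is_slot /tailv /headv /=; split=> //; congr (_, _);
  by apply: val_inj; rewrite /= inordK.
Qed.

Lemma entry_stateS w (i : 'I_n.+1) :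
  entry_state covered w i.+1 = exit_state (tnth w i).
Proof. by rewrite -nth_wordE. Qed.

(** Degree bounds and hexagon edges give the first conjunct of [admissible] at their own hexagon;
    the link from hexagon [i] to [i + 1] gives the second conjunct at [i + 1]; closedness gives the
    end condition. *)
Lemma good_maximal w :
  maximal_matching (matching_of w) && word_closed w = good covered w.
Proof.
rewrite maximal_matchingE; apply/andP/idP.
  move=> [/and3P[_ /forallP degM /forall_inP covM] cw].
  have cov e : is_slot e -> (0 < degree (matching_of w) (tailv e)) ||
                            (0 < degree (matching_of w) (headv e)).
    move=> se.
    rewrite -(exists_in_edge_of e (fun v => 0 < degree (matching_of w) v)).
    by apply: covM; rewrite edgesE imset_f // inE.
  apply/goodP; rewrite size_tuple; split=> [i hi|]; last first.
    rewrite /= (nth_wordE w ord_max); apply/negP => wn.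
    have := wbit_slot (e := (ord_max, ord_max)) cw wn.
    by rewrite /is_slot /= ltnn.
  pose o := Ordinal hi; rewrite (nth_wordE w o); apply/andP; split.
    apply/allP => k; rewrite mem_iota add0n => /andP[_ k6].
    have := degM (o, Ordinal k6); rewrite degree_matching_of //= => -> /=.
    have [se te he] := hexagon_edge_of o (Ordinal k6).
    by have := cov _ se; rewrite te he !degree_matching_of //= inordK ?ltn_mod.
  case: i hi @o => [//|j] hj o; apply/implyP.
  have hj' : j < n.+1 by apply: ltnW.
  have [se te he] := @link_edge_of (Ordinal hj') hj.
  have := cov _ se; rewrite te he !degree_matching_of //.
  case/orP=> [h|h _]; last exact: h.
  rewrite (entry_stateS w (Ordinal hj')).
  by rewrite (exit_exposed (entry_state covered w j).1) [0 < _]h.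
move=> gw; have cw := good_closed gw; split=> //.
have [adm _] := goodP _ _ gw; rewrite size_tuple in adm.
apply/and3P; split.
- apply/subsetP => E /imsetP[e]; rewrite inE => we ->.
  by rewrite edgesE imset_f // inE (wbit_slot cw).
- apply/forallP => -[i k]; rewrite degree_matching_of //=.
  have /andP[/allP/(_ k)] := adm i (ltn_ord i).
  by rewrite mem_iota ltn_ord nth_wordE => /(_ isT)/andP[].
apply/forall_inP => E; rewrite edgesE => /imsetP[e]; rewrite inE => se ->.
rewrite (exists_in_edge_of e (fun v => 0 < degree (matching_of w) v)).
case: e se => i k; rewrite /is_slot /=; have [k6 _|k6 /= hi] := ltnP k 6.
  have -> : k = widen_ord (leqnSn 6) (Ordinal k6) by apply: val_inj.
  have [_ -> ->] := hexagon_edge_of i (Ordinal k6).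
  rewrite !degree_matching_of //.
  have /andP[/allP/(_ k)] := adm i (ltn_ord i).
  rewrite mem_iota k6 nth_wordE => /(_ isT)/andP[_] h _ /=.
  by rewrite inordK ?ltn_mod.
have hi' : i.+1 < n.+1 by [].
have -> : k = ord_max by apply: val_inj => /=; have := ltn_ord k; lia.
have [se te he] := @link_edge_of i hi'; rewrite te he !degree_matching_of //.
have /andP[_] := adm i.+1 hi'; rewrite (nth_wordE w (Ordinal hi')) entry_stateS.
rewrite (exit_exposed (entry_state covered w i).1) implyNb -entry_stateS; exact.
Qed.

Lemma sum_maximal (F : nat -> nat) :
  \sum_(M | @maximal_matching chain M) F #|M| =
  \sum_(w : n.+1.-tuple letter | good covered w) F (weight w).
Proof.
rewrite (reindex_onto matching_of word_of) => [|M mM]; last first.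
  by apply: word_ofK; move: mM; rewrite maximal_matchingE => /and3P[].
under eq_bigl do rewrite matching_ofK good_maximal.
by apply: eq_bigr => w /good_closed/card_matching_of ->.
Qed.

Lemma T0_chain : T0 chain = good_count covered n.+1.
Proof. by rewrite /T0 cardsE -sum1_card (sum_maximal (fun=> 1)). Qed.

Lemma T1_chain : T1 chain = good_weight covered n.+1.
Proof. exact: (sum_maximal id). Qed.

Lemma matching_number_chain : matching_number chain = 3 * n.+1.
Proof.
apply/eqP; rewrite eqn_leq; apply/andP; split.
  apply/bigmax_leqP => M /matching_card.
  by rewrite card_prod !card_ord; lia.
pose w := [tuple of nseq n.+1 kekule_letter].
have gw : good covered w by apply: good_kekule.
have := gw; rewrite -good_maximal => /andP[/maxsetp mw cw].
have <- : #|matching_of w| = 3 * n.+1.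
  by rewrite card_matching_of //; exact: weight_kekule.
exact: (@leq_bigmax_cond _ _ (fun M : {set {set vertex chain}} => #|M|)).
Qed.

End Chain.

(** * Asymptotics of the recurrences *)

From mathcomp Require Import all_classical all_reals all_analysis.
From mathcomp Require Import ring lra.
Import Order.TTheory GRing.Theory Num.Theory.
Import numFieldNormedType.Exports.
Local Open Scope classical_set_scope.
Local Open Scope ring_scope.

Lemma bounded_recurrence2 (R : realFieldType) (p q c B : R) (u g : nat -> R) :
  `|p| + `|q| <= c -> c < 1 -> (forall n, `|g n| <= B) ->
  (forall n, u n.+2 = p * u n.+1 + q * u n + g n) ->
  exists C, forall n, `|u n| <= C.
Proof.
move=> pqc c1 gB uE.
have B0 : 0 <= B := le_trans (normr_ge0 _) (gB 0%N).
(* [C] bounds both initial values and satisfies [c * C + B <= C], so the bound propagates. *)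
pose C := `|u 0%N| + `|u 1%N| + B / (1 - c).
have cB : B = (1 - c) * (B / (1 - c)) by field; lra.
have D0 : 0 <= B / (1 - c) by rewrite divr_ge0//; lra.
have u0 := normr_ge0 (u 0%N); have u1 := normr_ge0 (u 1%N).
have p0 := normr_ge0 p; have q0 := normr_ge0 q.
exists C => n; suff: `|u n| <= C /\ `|u n.+1| <= C by case.
elim: n => [|n [IH1 IH2]]; first by rewrite /C; split; lra.
split=> //; rewrite uE.
have := ler_normD (p * u n.+1 + q * u n) (g n).
have := ler_normD (p * u n.+1) (q * u n).
rewrite !normrM; have := gB n.
have : `|p| * `|u n.+1| <= `|p| * C by rewrite ler_wpM2l.
have : `|q| * `|u n| <= `|q| * C by rewrite ler_wpM2l.
have : (`|p| + `|q|) * C <= c * C by rewrite ler_wpM2r// /C; lra.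
have : B <= (1 - c) * C by rewrite {1}cB ler_wpM2l /C; lra.
lra.
Qed.

Lemma geometric_bound (R : realFieldType) (r B : R) (u : nat -> R) :
  2 <= r -> 0 <= B -> (forall n, `|u n.+1 - r * u n| <= B) ->
  forall n, `|u n| <= (`|u 0%N| + B) * r ^+ n.
Proof.
(* The extra [B] makes the induction close, because [2 * B <= r * B]. *)
move=> r2 B0 uB n; suff: `|u n| + B <= (`|u 0%N| + B) * r ^+ n by lra.
elim: n => [|n IHn]; first by rewrite expr0 mulr1.
have := ler_normD (u n.+1 - r * u n) (r * u n); rewrite subrK normrM.
have -> : `|r| = r by rewrite ger0_norm//; lra.
have : r * (`|u n| + B) <= r * ((`|u 0%N| + B) * r ^+ n).
  by rewrite ler_wpM2l//; lra.
have : 2 * B <= r * B by rewrite ler_wpM2r.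
by have := uB n; rewrite exprS; lra.
Qed.

Definition dominant_root (R : realFieldType) (r : R) :=
  [/\ r ^+ 3 = 7 * r ^+ 2 - 2 * r + 2, 13 / 2 < r & r < 7].

Definition count_recurrence (R : realFieldType) (t : nat -> R) :=
  [/\ t 0%N = 1, t 1%N = 5, t 2%N = 33 &
      forall n, t n.+3 = 7 * t n.+2 - 2 * t n.+1 + 2 * t n].

(* X^3 - 7 X^2 + 2 X - 2 = (X - r) (X^2 - (7 - r) X + q), and the coefficients
   of the quadratic factor are small enough to make it contracting. *)
Lemma cofactor_contraction (R : realFieldType) (r : R) : dominant_root r ->
  let q := r ^+ 2 - 7 * r + 2 in
  [/\ 0 < q, q < 1 / 3 & `|7 - r| + `|- q| <= 5 / 6].
Proof.
move=> [rE r_gt r_lt] q; have r0 : 0 < r by lra.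
(* The product of the roots is 2, hence q = 2 / r, which is below 1/3 as r > 6. *)
have qr : q * r = 2 by rewrite /q; ring: rE.
have q0 : 0 < q by rewrite -(pmulr_lgt0 _ r0) qr.
have q1 : q < 1 / 3 by rewrite -(ltr_pM2r r0) qr; lra.
by split=> //; rewrite normrN !gtr0_norm//; lra.
Qed.

(** The recurrence has order three, so the induction carries the bounds for two consecutive
    steps. *)
Lemma count_growth (R : realFieldType) (t : nat -> R) : count_recurrence t ->
  forall n, [/\ 0 < t n, t n <= t n.+1, t n.+1 <= 7 * t n,
    t n.+1 <= t n.+2 & t n.+2 <= 7 * t n.+1].
Proof.
move=> [t0 t1 t2 tE]; elim=> [|n [h1 h2 h3 h4 h5]].
  by rewrite t0 t1 t2; split; lra.
by split; rewrite ?tE; lra.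
Qed.

(** The cofactor applied to [t] leaves a geometric sequence of ratio [r] with constant above 30,
    while its value is at most (49 + 1/3) [t n] by the growth bounds. *)
Lemma root_exp_le (R : realFieldType) (r : R) (t : nat -> R) :
  dominant_root r -> count_recurrence t -> forall n, r ^+ n <= 2 * t n.
Proof.
move=> rP tP n; have [q0 q1 _] := cofactor_contraction rP.
have [h1 h2 h3 h4 h5] := count_growth tP n.
case: rP tP => rE r_gt r_lt [t0 t1 t2 tE].
move: q0 q1; set q := (r ^+ 2 - 7 * r + 2) => q0 q1.
have H k : t k.+2 + (r - 7) * t k.+1 + q * t k =
           (33 + (r - 7) * 5 + q) * r ^+ k.
  elim: k => [|k IHk]; first by rewrite t0 t1 t2 expr0; ring.
  by rewrite exprS mulrCA -IHk tE /q; ring: rE.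
have rn : 0 < r ^+ n by rewrite exprn_gt0//; lra.
have : 30 * r ^+ n <= (33 + (r - 7) * 5 + q) * r ^+ n.
  by rewrite ler_wpM2r//; lra.
have : q * t n <= 1 / 3 * t n by rewrite ler_wpM2r//; lra.
have : (r - 7) * t n.+1 <= 0 by rewrite mulr_le0_ge0//; lra.
by rewrite -H; lra.
Qed.

(** Applying X - r first leaves the recurrence of the contracting cofactor, with no forcing term. *)
Lemma count_defect_bounded (R : realFieldType) (r : R) (t : nat -> R) :
  dominant_root r -> count_recurrence t ->
  exists C, forall n, `|t n.+1 - r * t n| <= C.
Proof.
move=> rP [_ _ _ tE]; have [_ _ H] := cofactor_contraction rP.
case: rP => rE _ _.
apply: (@bounded_recurrence2 _ _ _ _ 0 _ (fun=> 0) H); first lra.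
  by move=> n; rewrite normr0.
by move=> n; rewrite tE; ring: rE.
Qed.

(* K is chosen so that the inhomogeneous term of the recurrence for
   s n - K n (t n) vanishes at r, hence only involves the bounded defects. *)
Lemma total_size_bound (R : realFieldType) (r K : R) (t s : nat -> R) :
  dominant_root r -> count_recurrence t ->
  (forall n, s n.+3 = 7 * s n.+2 - 2 * s n.+1 + 2 * s n
     + (16 * t n.+2 - 3 * t n.+1 + 12 * t n)) ->
  K * (7 * r ^+ 2 - 4 * r + 6) = 16 * r ^+ 2 - 3 * r + 12 ->
  exists C, forall n, `|s n - K * n%:R * t n| <= C * t n.
Proof.
move=> rP tP sE KE; have [C dC] := count_defect_bounded rP tP.
have [_ _ Hc] := cofactor_contraction rP.
have rt := root_exp_le rP tP; case: rP tP => rE r_gt _ [_ _ _ tE].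
pose D n := s n - K * n%:R * t n.
pose d n := t n.+1 - r * t n.
(* The forcing term of [D] has symbol b X^2 + (4 K - 3) X + (12 - 6 K), which vanishes at [r] by
   [KE]; b X + a is its quotient by X - r. *)
pose a := (16 - 7 * K) * r - 3 + 4 * K; pose b := 16 - 7 * K.
pose g n := a * d n + b * d n.+1.
(* Applying X - r to [D] leaves the cofactor recurrence with bounded forcing [g]. *)
have [E FE] : exists E, forall n, `|D n.+1 - r * D n| <= E.
  apply: (@bounded_recurrence2 _ _ _ _ (`|a| * C + `|b| * C) _ g Hc); first lra.
    move=> n; apply: le_trans (ler_normD _ _) _.
    by rewrite !normrM lerD// ler_wpM2l// dC.
  move=> n; suff -> : D n.+3 = 7 * D n.+2 - 2 * D n.+1 + 2 * D n + g n.
    by ring: rE.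
  have -> : g n = b * t n.+2 + (4 * K - 3) * t n.+1
      - (b * r ^+ 2 + (4 * K - 3) * r) * t n by rewrite /g /a /b /d; ring.
  have -> : b * r ^+ 2 + (4 * K - 3) * r = 6 * K - 12 by rewrite /b; lra.
  rewrite /D sE tE /b -(natr1 n.+2) -(natr1 n.+1) -(natr1 n).
  by ring.
have E0 : 0 <= E := le_trans (normr_ge0 _) (FE 0%N).
exists ((`|D 0%N| + E) * 2) => n.
have r2 : 2 <= r by lra.
apply: le_trans (geometric_bound r2 E0 FE n) _.
by rewrite -mulrA ler_wpM2l ?rt// addr_ge0.
Qed.

Lemma average_size_cvg (R : realType) (r : R) (t s : nat -> R) :
  dominant_root r -> count_recurrence t ->
  (forall n, s n.+3 = 7 * s n.+2 - 2 * s n.+1 + 2 * s n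
     + (16 * t n.+2 - 3 * t n.+1 + 12 * t n)) ->
  s n / (n%:R * t n) @[n --> \oo]
    --> (16 * r ^+ 2 - 3 * r + 12) / (7 * r ^+ 2 - 4 * r + 6).
Proof.
move=> rP tP sE; set K := _ / _.
have KE : K * (7 * r ^+ 2 - 4 * r + 6) = 16 * r ^+ 2 - 3 * r + 12.
  by rewrite /K divfK// gt_eqF//; case: rP => _ r_gt _; nra.
have [C DC] := total_size_bound rP tP sE KE.
have tpos n : 0 < t n by have [] := count_growth tP n.
(* Dividing the bound [C * t n] by [n * t n] leaves an error of at most [C / n]. *)
apply/cvgrPdist_le => e e0; near=> n.
have n0 : (0 < n)%N by near: n; exact: nbhs_infty_gt.
have n0R : (0 : R) < n%:R by rewrite ltr0n.
have -> : K - s n / (n%:R * t n) = - (s n - K * n%:R * t n) / (n%:R * t n).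
  by field; rewrite !gt_eqF.
rewrite normrM normrN normfV (gtr0_norm (mulr_gt0 n0R (tpos n))).
rewrite ler_pdivrMr ?mulr_gt0// (le_trans (DC n))// mulrA.
rewrite ler_wpM2r ?(ltW (tpos n))//.
have : C / e <= n%:R by near: n; exact: nbhs_infty_ger.
by rewrite ler_pdivrMr// mulrC.
Unshelve. all: by end_near. Qed.

Lemma cardano_root (R : realType) (r : R) :
  r = (7 + (307 + 9 * Num.sqrt 182) `^ (3^-1)
                  + (307 - 9 * Num.sqrt 182) `^ (3^-1)) / 3 ->
  dominant_root r.
Proof.
set w := Num.sqrt 182; set x := _ `^ _; set y := _ `^ _ => rE.
have w2 : w ^+ 2 = 182 by rewrite sqr_sqrtr//; lra.
have w0 : 0 <= w by rewrite sqrtr_ge0.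
(* Both radicands are thus nonnegative, so their powers of exponent 1/3 are true cube roots. *)
have wlt : 9 * w < 307 by nra.
have cube (z : R) : 0 <= z -> (z `^ 3^-1) ^+ 3 = z.
  move=> z0; rewrite -powR_mulrn ?powR_ge0// -powRrM.
  by rewrite mulVf ?pnatr_eq0// powRr1.
have x3 : x ^+ 3 = 307 + 9 * w by rewrite cube//; lra.
have y3 : y ^+ 3 = 307 - 9 * w by rewrite cube//; lra.
have x0 : 0 <= x by rewrite powR_ge0.
have y0 : 0 <= y by rewrite powR_ge0.
(* 307^2 - 81 * 182 = 43^3. *)
have xy : x * y = 43.
  apply/eqP; rewrite -(@eqrXn2 _ 3)// ?mulr_ge0// ?ler0n//.
  by rewrite exprMn x3 y3; apply/eqP; ring: w2.
have r3 : r ^+ 3 = 7 * r ^+ 2 - 2 * r + 2.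
  have xyr : x + y = 3 * r - 7 by rewrite rE; lra.
  have : (x + y) ^+ 3 = x ^+ 3 + y ^+ 3 + 3 * (x * y) * (x + y) by ring.
  rewrite x3 y3 xy xyr; lra.
have r0 : 7 / 3 <= r by rewrite rE; lra.
(* In this form, r <= 13/2 would force (r - 2)^2 <= 0, and r >= 7 would make the left side
   nonpositive and the right side positive. *)
have r2 : r ^+ 2 * (7 - r) = 2 * r - 2 by lra.
split=> //.
  rewrite ltNge; apply/negP => r_le.
  have : r ^+ 2 * (1 / 2) <= r ^+ 2 * (7 - r).
    by rewrite ler_wpM2l ?sqr_ge0//; lra.
  have : 0 < (r - 2) ^+ 2 by rewrite exprn_gt0//; lra.
  by rewrite r2; lra.
rewrite ltNge; apply/negP => r_ge.
have : r ^+ 2 * (7 - r) <= 0 by rewrite mulr_ge0_le0 ?sqr_ge0//; lra.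
by rewrite r2; lra.
Qed.

Lemma good_count_recurrence (R : realFieldType) :
  count_recurrence (fun n => (good_count covered n)%:R : R).
Proof.
have [t0 t1 t2] := good_count_init; split=> [|||n]; rewrite ?t0 ?t1 ?t2 //.
have /(congr1 (GRing.natmul (1 : R))) := good_count_rec n.
by rewrite !(natrM, natrD); lra.
Qed.

Theorem theorem3 (R : realType) :
  let r : R := (7 + (307 + 9 * Num.sqrt 182) `^ (3^-1)
                  + (307 - 9 * Num.sqrt 182) `^ (3^-1)) / 3 in
  matching_ratio (meta_phenylene_chain n) R @[n --> \oo]
    --> (16 * r ^+ 2 - 3 * r + 12) / (3 * (7 * r ^+ 2 - 4 * r + 6)).
Proof.
move=> r; have rP : dominant_root r by exact: cardano_root.
pose s n : R := (good_weight covered n)%:R.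
pose t n : R := (good_count covered n)%:R.
have sE n : s n.+3 = 7 * s n.+2 - 2 * s n.+1 + 2 * s n
    + (16 * t n.+2 - 3 * t n.+1 + 12 * t n).
  have /(congr1 (GRing.natmul (1 : R))) := good_weight_rec n.
  by rewrite /s /t !(natrM, natrD); lra.
have := average_size_cvg rP (good_count_recurrence R) sE.
(* The formulas for the chain concern n + 1 hexagons, so both limits are taken along the shifted
   index. *)
rewrite -cvg_shiftS => st.
rewrite -(cvg_shiftS (fun n => matching_ratio (meta_phenylene_chain n) R)).
have -> : (16 * r ^+ 2 - 3 * r + 12) / (3 * (7 * r ^+ 2 - 4 * r + 6)) =
    3^-1 * ((16 * r ^+ 2 - 3 * r + 12) / (7 * r ^+ 2 - 4 * r + 6)).
  by rewrite invfM mulrCA.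
under eq_fun => n.
  rewrite /matching_ratio matching_number_chain T0_chain T1_chain /=.
  rewrite natrM -[3%:R * _ * _]mulrA invfM mulrCA.
  over.
exact: cvgMl_tmp st.
Qed.
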